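(* Let $(\mathcal{L},\mathcal{R})$ be a weak factorization system on a Cauchy complete category $\mathcal{C}$. The following are equivalent: (1) There is a subclass $\mathcal{D}\subseteq\mathcal{R}$ such that $\overline{\mathcal{D}}=\mathcal{R}$ and $(\mathcal{C},\mathcal{D})$ is a display map category which models $\Sigma$-types and functorial $\mathrm{Id}$-types. (2) $(\mathcal{C},\mathcal{R})$ is a display map category which models $\Sigma$-types and functorial $\mathrm{Id}$-types. The following are also equivalent: (1') There is a subclass $\mathcal{D}\subseteq\mathcal{R}$ such that $\overline{\mathcal{D}}=\mathcal{R}$ and $(\mathcal{C},\mathcal{D})$ is a display map category which models $\Sigma$-types, functorial $\mathrm{Id}$-types, and $\Pi$-types. (2') $(\mathcal{C},\mathcal{R})$ is a display map category which models $\Sigma$-types, functorial $\mathrm{Id}$-types, and $\Pi$-types.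
   Context: A category is Cauchy complete if every idempotent $e=e^2:C\to C$ splits, i.e. $e=ir$ with $r:C\to R$, $i:R\to C$ and $ri=1_R$. For a class $\mathcal{M}$ of morphisms of $\mathcal{C}$, ${}^{\square}\mathcal{M}$ is the class of morphisms having the left lifting property against all morphisms of $\mathcal{M}$, $\mathcal{M}^{\square}$ is the class of morphisms having the right lifting property against all morphisms of $\mathcal{M}$, and $\overline{\mathcal{M}} := ({}^{\square}\mathcal{M})^{\square}$. A display map category $(\mathcal{C},\mathcal{D})$ is a category $\mathcal{C}$ with a terminal object and a class $\mathcal{D}$ of morphisms of $\mathcal{C}$ (called display maps) such that: (1) $\mathcal{D}$ contains every isomorphism; (2) $\mathcal{D}$ contains every morphism whose codomain is a terminal object; (3) every pullback of every morphism of $\mathcal{D}$ (along any morphism of $\mathcal{C}$) exists; (4) $\mathcal{D}$ is stable under pullback. $(\mathcal{C},\mathcal{D})$ models $\Sigma$-types if $\mathcal{D}$ is closed under composition. $(\mathcal{C},\mathcal{D})$ models $\Pi$-types if for every pair of composable display maps $g:W\to X$ and $f:X\to Y$ there is a display map $\Pi_f g$ with codomain $Y$ and bijections $\mathcal{C}/Y(y,\Pi_f g)\cong \mathcal{C}/X(f^*y,g)$ natural in $y\in\mathcal{C}/Y$, where $f^*y$ is the pullback of $y$ along $f$. Suppose $(\mathcal{C},\mathcal{D})$ models $\Sigma$-types. It models $\mathrm{Id}$-types if for every $f:X\to Y$ in $\mathcal{D}$: (1) the diagonal $\Delta_f:f\to f\times f$ in $\mathcal{C}/Y$ (where $f\times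 f: X\times_Y X\to Y$) has a factorization in $\mathcal{C}/Y$, $\Delta_f=\epsilon_f r_f$, with $r_f:X\to \mathrm{Id}(f)$, $\epsilon_f:\mathrm{Id}(f)\to X\times_Y X$, and $\iota_f:\mathrm{Id}(f)\to Y$ the structure map; such that (2) $\epsilon_f\in\mathcal{D}$; and (3) for every morphism $\alpha:A\to X$ of $\mathcal{C}$ and each $i=0,1$, the morphism $\alpha^*r_f:A\to\alpha^*\mathrm{Id}(f)$ is in ${}^{\square}\mathcal{D}$, where $\pi_0,\pi_1:X\times_Y X\to X$ are the projections, $\alpha^*\mathrm{Id}(f)$ is the pullback of $\pi_i\epsilon_f:\mathrm{Id}(f)\to X$ along $\alpha$, and $\alpha^*r_f$ is the pullback along $\alpha$ of $r_f$ regarded as a morphism $1_X\to\pi_i\epsilon_f$ of $\mathcal{C}/X$. For an object $Y$, $\mathcal{D}/Y$ is the full subcategory of $\mathcal{C}/Y$ on the display maps, and $\mathcal{F}$ is the category $\bullet\to\bullet\to\bullet$, so $(\mathcal{D}/Y)^{\mathcal{F}}$ is the category of composable pairs of morphisms of $\mathcal{D}/Y$. $(\mathcal{C},\mathcal{D})$ functorially models $\mathrm{Id}$-types (models functorial $\mathrm{Id}$-types) if it models $\mathrm{Id}$-types and for each object $Y$ there is a functor $\mathcal{D}/Y\to(\mathcal{D}/Y)^{\mathcal{F}}$ which provides the factorizations $f\xrightarrow{r_f}\iota_f\xrightarrow{\epsilon_f}f\times f$ of part (1) (satisfying (2) and (3)); that is, it is a functorial factorization of the diagonals, acting on a morphism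 $h:f\to g$ of $\mathcal{D}/Y$ with outer components $h$ and $h\times h$. *)

(* Defs.v *)
From Corelib Require Import ssreflect ssrfun.
From Stdlib Require Import ProofIrrelevance.

Set Implicit Arguments.
Unset Strict Implicit.
Unset Printing Implicit Defensive.

Declare Scope cat_scope.
Delimit Scope cat_scope with cat.
Open Scope cat_scope.

Record Category : Type := {
  Obj :> Type;
  Hom : Obj -> Obj -> Type;
  idm : forall X : Obj, Hom X X;
  comp : forall X Y Z : Obj, Hom Y Z -> Hom X Y -> Hom X Z;
  comp_id_l : forall (X Y : Obj) (f : Hom X Y), comp (idm Y) f = f;
  comp_id_r : forall (X Y : Obj) (f : Hom X Y), comp f (idm X) = f;
  comp_assoc : forall (W X Y Z : Obj) (h : Hom Y Z) (g : Hom X Y) (f : Hom W X),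
    comp h (comp g f) = comp (comp h g) f
}.

Arguments Hom {c} X Y.
Arguments idm {c} X.
Arguments comp {c X Y Z} g f.

Notation "g ∘ f" := (comp g f) (at level 40, left associativity) : cat_scope.

Definition is_iso (C : Category) (X Y : C) (f : Hom X Y) : Prop :=
  exists g : Hom Y X, g ∘ f = idm X /\ f ∘ g = idm Y.

Definition is_terminal (C : Category) (T : C) : Prop :=
  forall X : C, exists ! f : Hom X T, True.

Definition Cauchy_complete (C : Category) : Prop :=
  forall (X : C) (e : Hom X X), e ∘ e = e ->
    exists (S : C) (r : Hom X S) (i : Hom S X), i ∘ r = e /\ r ∘ i = idm S.

(* [F1] makes the object map [F0] a functor. *)
Definition is_functor (C E : Category) (F0 : C -> E)
    (F1 : forall X Y : C, Hom X Y -> Hom (F0 X) (F0 Y)) : Prop :=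
  (forall X : C, F1 X X (idm X) = idm (F0 X)) /\
  (forall (X Y Z : C) (g : Hom Y Z) (f : Hom X Y),
     F1 X Z (g ∘ f) = F1 Y Z g ∘ F1 X Y f).

Definition MorClass (C : Category) : Type :=
  forall X Y : C, Hom X Y -> Prop.

Definition subclass (C : Category) (M N : MorClass C) : Prop :=
  forall (X Y : C) (f : Hom X Y), M X Y f -> N X Y f.

Definition eqclass (C : Category) (M N : MorClass C) : Prop :=
  forall (X Y : C) (f : Hom X Y), M X Y f <-> N X Y f.

Definition lifts (C : Category) (A B X Y : C) (l : Hom A B) (r : Hom X Y) : Prop :=
  forall (u : Hom A X) (v : Hom B Y), r ∘ u = v ∘ l ->
    exists d : Hom B X, d ∘ l = u /\ r ∘ d = v.

Definition llp (C : Category) (M : MorClass C) : MorClass C :=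
  fun A B l => forall (X Y : C) (r : Hom X Y), M X Y r -> lifts l r.

Definition rlp (C : Category) (M : MorClass C) : MorClass C :=
  fun X Y r => forall (A B : C) (l : Hom A B), M A B l -> lifts l r.

Definition closure (C : Category) (M : MorClass C) : MorClass C := rlp (llp M).

Definition weak_factorization_system (C : Category) (L R : MorClass C) : Prop :=
  eqclass L (llp R) /\ eqclass R (rlp L) /\
  forall (X Y : C) (f : Hom X Y),
    exists (M : C) (l : Hom X M) (r : Hom M Y), L X M l /\ R M Y r /\ r ∘ l = f.

(* A pullback of the cospan [f], [g]; "exists" is rendered by [inhabited]. *)
Record Pullback (C : Category) (A B Y : C) (f : Hom A Y) (g : Hom B Y) : Type := {
  apex :> C;
  pr1 : Hom apex A;
  pr2 : Hom apex B;
  pb_comm : f ∘ pr1 = g ∘ pr2;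
  pb_lift : forall (Z : C) (u : Hom Z A) (v : Hom Z B), f ∘ u = g ∘ v -> Hom Z apex;
  pb_lift1 : forall (Z : C) (u : Hom Z A) (v : Hom Z B) (e : f ∘ u = g ∘ v),
    pr1 ∘ pb_lift e = u;
  pb_lift2 : forall (Z : C) (u : Hom Z A) (v : Hom Z B) (e : f ∘ u = g ∘ v),
    pr2 ∘ pb_lift e = v;
  pb_uniq : forall (Z : C) (w w' : Hom Z apex),
    pr1 ∘ w = pr1 ∘ w' -> pr2 ∘ w = pr2 ∘ w' -> w = w'
}.

Arguments pr1 {C A B Y f g} p.
Arguments pr2 {C A B Y f g} p.
Arguments pb_lift {C A B Y f g} p {Z u v} e.

Lemma pb_map_subproof (C : Category) (A B A' B' Y : C)
    (f : Hom A Y) (g : Hom B Y) (f' : Hom A' Y) (g' : Hom B' Y)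
    (P : Pullback f g) (a : Hom A A') (b : Hom B B')
    (ea : f' ∘ a = f) (eb : g' ∘ b = g) :
  f' ∘ (a ∘ pr1 P) = g' ∘ (b ∘ pr2 P).
Proof. by rewrite !comp_assoc ea eb (pb_comm P). Qed.

(* The map a ×_Y b : A ×_Y B -> A' ×_Y B'. *)
Definition pb_map (C : Category) (A B A' B' Y : C)
    (f : Hom A Y) (g : Hom B Y) (f' : Hom A' Y) (g' : Hom B' Y)
    (P : Pullback f g) (P' : Pullback f' g') (a : Hom A A') (b : Hom B B')
    (ea : f' ∘ a = f) (eb : g' ∘ b = g) : Hom P P' :=
  pb_lift P' (pb_map_subproof P ea eb).

(* The pullback of 1_X along α : A -> X, chosen to be 1_A. *)
Definition pb_id (C : Category) (A X : C) (α : Hom A X) : Pullback α (idm X).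
Proof.
refine (@Build_Pullback C A X X α (idm X) A (idm A) α _
          (fun Z u v _ => u) _ _ _).
- by rewrite comp_id_l comp_id_r.
- by move=> Z u v e; rewrite comp_id_l.
- by move=> Z u v e; rewrite e comp_id_l.
- by move=> Z w w'; rewrite !comp_id_l.
Defined.

Definition diagonal (C : Category) (X Y : C) (f : Hom X Y) (P : Pullback f f) :
    Hom X P :=
  pb_lift P (erefl (f ∘ idm X)).

Record slice_obj (C : Category) (Y : C) : Type := Over {
  dom : C;
  str : Hom dom Y
}.

Arguments Over {C Y dom} str.
Arguments dom {C Y} s.
Arguments str {C Y} s.

Record slice_hom (C : Category) (Y : C) (a b : slice_obj Y) : Type := OverHom {
  under :> Hom (dom a) (dom b);
  under_str : str b ∘ under = str a
}.

Lemma slice_hom_eq (C : Category) (Y : C) (a b : slice_obj Y) (h k : slice_hom a b) :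
  under h = under k -> h = k.
Proof.
case: h k => [h eh] [k ek] /= e; subst k.
by rewrite (proof_irrelevance _ eh ek).
Qed.

Definition slice_id (C : Category) (Y : C) (a : slice_obj Y) : slice_hom a a :=
  OverHom (comp_id_r (str a)).

Definition slice_comp (C : Category) (Y : C) (a b c : slice_obj Y)
    (k : slice_hom b c) (h : slice_hom a b) : slice_hom a c.
Proof.
exists (under k ∘ under h).
by rewrite comp_assoc !under_str.
Defined.

Definition Slice (C : Category) (Y : C) : Category.
Proof.
refine (@Build_Category (slice_obj Y) (@slice_hom C Y)
          (@slice_id C Y) (@slice_comp C Y) _ _ _).
- by move=> a b h; apply: slice_hom_eq; apply: comp_id_l.
- by move=> a b h; apply: slice_hom_eq; apply: comp_id_r.
- by move=> a b c d k h l; apply: slice_hom_eq; apply: comp_assoc.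
Defined.

Definition FullSub (C : Category) (P : C -> Prop) : Category.
Proof.
refine (@Build_Category {X : C | P X}
          (fun X Y => Hom (proj1_sig X) (proj1_sig Y))
          (fun X => idm (proj1_sig X))
          (fun X Y Z g f => g ∘ f) _ _ _).
- by move=> *; apply: comp_id_l.
- by move=> *; apply: comp_id_r.
- by move=> *; apply: comp_assoc.
Defined.

Record pair_obj (C : Category) : Type := CPair {
  ob0 : C; ob1 : C; ob2 : C;
  ar01 : Hom ob0 ob1;
  ar12 : Hom ob1 ob2
}.

Arguments CPair {C ob0 ob1 ob2} ar01 ar12.

Record pair_hom (C : Category) (p q : pair_obj C) : Type := CPairHom {
  hom0 : Hom (ob0 p) (ob0 q);
  hom1 : Hom (ob1 p) (ob1 q);
  hom2 : Hom (ob2 p) (ob2 q);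
  hom_sq01 : hom1 ∘ ar01 p = ar01 q ∘ hom0;
  hom_sq12 : hom2 ∘ ar12 p = ar12 q ∘ hom1
}.

Lemma pair_hom_eq (C : Category) (p q : pair_obj C) (h k : pair_hom p q) :
  hom0 h = hom0 k -> hom1 h = hom1 k -> hom2 h = hom2 k -> h = k.
Proof.
case: h k => [h0 h1 h2 a b] [k0 k1 k2 c d] /= e0 e1 e2; subst.
by rewrite (proof_irrelevance _ a c) (proof_irrelevance _ b d).
Qed.

Definition pair_id (C : Category) (p : pair_obj C) : pair_hom p p.
Proof.
exists (idm _) (idm _) (idm _); by rewrite comp_id_l comp_id_r.
Defined.

Definition pair_comp (C : Category) (p q s : pair_obj C)
    (k : pair_hom q s) (h : pair_hom p q) : pair_hom p s.
Proof.
exists (hom0 k ∘ hom0 h) (hom1 k ∘ hom1 h) (hom2 k ∘ hom2 h).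
- by rewrite -comp_assoc hom_sq01 comp_assoc hom_sq01 comp_assoc.
- by rewrite -comp_assoc hom_sq12 comp_assoc hom_sq12 comp_assoc.
Defined.

(* The functor category C^F for F = (• -> • -> •). *)
Definition ComposablePairs (C : Category) : Category.
Proof.
refine (@Build_Category (pair_obj C) (@pair_hom C) (@pair_id C) (@pair_comp C) _ _ _).
- by move=> *; apply: pair_hom_eq; apply: comp_id_l.
- by move=> *; apply: pair_hom_eq; apply: comp_id_r.
- by move=> *; apply: pair_hom_eq; apply: comp_assoc.
Defined.

Record display_map_category (C : Category) (D : MorClass C) : Prop := {
  dm_has_terminal : exists T : C, is_terminal T;
  dm_iso : forall (X Y : C) (f : Hom X Y), is_iso f -> D X Y f;
  dm_terminal : forall (X T : C) (f : Hom X T), is_terminal T -> D X T f;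
  dm_pullback : forall (X Y Z : C) (f : Hom X Y) (g : Hom Z Y),
    D X Y f -> inhabited (Pullback g f);
  dm_stable : forall (X Y Z : C) (f : Hom X Y) (g : Hom Z Y) (P : Pullback g f),
    D X Y f -> D P Z (pr1 P)
}.

Definition models_Sigma (C : Category) (D : MorClass C) : Prop :=
  forall (X Y Z : C) (g : Hom Y Z) (f : Hom X Y),
    D X Y f -> D Y Z g -> D X Z (g ∘ f).

(* f^*y and f^*u, computed with given pullbacks. *)
Definition pb_obj (C : Category) (X Y : C) (f : Hom X Y) (y : Slice Y)
    (P : Pullback f (str y)) : Slice X :=
  Over (pr1 P).

Lemma pb_hom_subproof (C : Category) (X Y : C) (f : Hom X Y) (y' y : Slice Y)
    (u : Hom y' y) (P' : Pullback f (str y')) (P : Pullback f (str y)) :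
  pr1 P ∘ pb_map P' P (comp_id_r f) (under_str u) = pr1 P'.
Proof. by rewrite pb_lift1 comp_id_l. Qed.

Definition pb_hom (C : Category) (X Y : C) (f : Hom X Y) (y' y : Slice Y)
    (u : Hom y' y) (P' : Pullback f (str y')) (P : Pullback f (str y)) :
    Hom (pb_obj P') (pb_obj P) :=
  @OverHom C X (pb_obj P') (pb_obj P) _ (pb_hom_subproof u P' P).

(* Rather than fixing a choice of the pullbacks f^*y, the bijections are given
   for every pullback of y along f, naturally in y and in that pullback; by
   uniqueness of pullbacks this is the same as for any one choice. *)
Definition models_Pi (C : Category) (D : MorClass C) : Prop :=
  forall (W X Y : C) (g : Hom W X) (f : Hom X Y), D W X g -> D X Y f ->
    exists (V : C) (p : Hom V Y), D V Y p /\
    exists φ : forall (y : Slice Y) (P : Pullback f (str y)),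
        @Hom (Slice Y) y (Over p) -> @Hom (Slice X) (pb_obj P) (Over g),
      (forall (y : Slice Y) (P : Pullback f (str y)), bijective (φ y P)) /\
      (forall (y' y : Slice Y) (u : Hom y' y)
         (P' : Pullback f (str y')) (P : Pullback f (str y))
         (h : @Hom (Slice Y) y (Over p)),
         φ y' P' (h ∘ u) = φ y P h ∘ pb_hom u P' P).

Lemma id_refl_subproof (C : Category) (X Y : C) (f : Hom X Y) (P : Pullback f f)
    (I : C) (r : Hom X I) (ε : Hom I P) (i : bool) :
  ε ∘ r = diagonal P -> ((if i then pr2 P else pr1 P) ∘ ε) ∘ r = idm X.
Proof.
move=> e; rewrite -comp_assoc e.
by case: i; [apply: pb_lift2 | apply: pb_lift1].
Qed.

(* The booleans false, true stand for i = 0, 1. *)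
Record id_type (C : Category) (D : MorClass C) (X Y : C) (f : Hom X Y) : Type := {
  id_sq : Pullback f f;
  id_ob : C;
  id_r : Hom X id_ob;
  id_ε : Hom id_ob id_sq;
  id_fact : id_ε ∘ id_r = diagonal id_sq;
  id_ε_display : D id_ob id_sq id_ε;
  id_r_lifting : forall (A : C) (α : Hom A X) (i : bool)
      (Q : Pullback α ((if i then pr2 id_sq else pr1 id_sq) ∘ id_ε)),
    llp D (pb_map (pb_id α) Q (comp_id_r α) (id_refl_subproof i id_fact))
}.

Definition models_Id (C : Category) (D : MorClass C) : Prop :=
  forall (X Y : C) (f : Hom X Y), D X Y f -> inhabited (id_type D f).

Definition display_over (C : Category) (D : MorClass C) (Y : C) : Slice Y -> Prop :=
  fun a => D (dom a) Y (str a).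

Definition DSlice (C : Category) (D : MorClass C) (Y : C) : Category :=
  FullSub (display_over D (Y := Y)).

Section IdFunctor.
Variables (C : Category) (D : MorClass C).
Hypotheses (hD : display_map_category D) (hS : models_Sigma D).
Variable Y : C.

(* The structure map of f × f is f ∘ π₀ = f ∘ π₁. *)
Definition id_square (f : DSlice D Y) (J : id_type D (str (proj1_sig f))) :
    DSlice D Y :=
  exist (display_over D (Y := Y))
    (Over (str (proj1_sig f) ∘ pr1 (id_sq J)))
    (hS (dm_stable hD (id_sq J) (proj2_sig f)) (proj2_sig f)).

Definition id_iota (f : DSlice D Y) (J : id_type D (str (proj1_sig f))) :
    DSlice D Y :=
  exist (display_over D (Y := Y))
    (Over ((str (proj1_sig f) ∘ pr1 (id_sq J)) ∘ id_ε J))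
    (hS (id_ε_display J) (proj2_sig (id_square J))).

Lemma id_r_over_subproof (f : DSlice D Y) (J : id_type D (str (proj1_sig f))) :
  str (proj1_sig (id_iota J)) ∘ id_r J = str (proj1_sig f).
Proof.
by rewrite /= -!comp_assoc id_fact pb_lift1 comp_id_r.
Qed.

Definition id_r_over (f : DSlice D Y) (J : id_type D (str (proj1_sig f))) :
    Hom f (id_iota J) :=
  @OverHom C Y (proj1_sig f) (proj1_sig (id_iota J)) (id_r J) (id_r_over_subproof J).

Definition id_ε_over (f : DSlice D Y) (J : id_type D (str (proj1_sig f))) :
    Hom (id_iota J) (id_square J) :=
  @OverHom C Y (proj1_sig (id_iota J)) (proj1_sig (id_square J)) (id_ε J) erefl.

Definition id_pair (f : DSlice D Y) (J : id_type D (str (proj1_sig f))) :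
    ComposablePairs (DSlice D Y) :=
  CPair (id_r_over J) (id_ε_over J).

Lemma square_hom_subproof (f g : DSlice D Y) (h : Hom f g)
    (J : id_type D (str (proj1_sig f))) (K : id_type D (str (proj1_sig g))) :
  str (proj1_sig (id_square K))
    ∘ pb_map (id_sq J) (id_sq K) (under_str h) (under_str h)
  = str (proj1_sig (id_square J)).
Proof. by rewrite /= -comp_assoc pb_lift1 comp_assoc under_str. Qed.

Definition square_hom (f g : DSlice D Y) (h : Hom f g)
    (J : id_type D (str (proj1_sig f))) (K : id_type D (str (proj1_sig g))) :
    Hom (id_square J) (id_square K) :=
  @OverHom C Y (proj1_sig (id_square J)) (proj1_sig (id_square K)) _
    (square_hom_subproof h J K).

End IdFunctor.

Definition models_functorial_Id (C : Category) (D : MorClass C)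
    (hD : display_map_category D) (hS : models_Sigma D) : Prop :=
  models_Id D /\
  forall Y : C,
    exists (J : forall f : DSlice D Y, id_type D (str (proj1_sig f)))
      (E : forall f g : DSlice D Y, Hom f g ->
         Hom (id_pair hD hS (J f)) (id_pair hD hS (J g))),
      is_functor E /\
      forall (f g : DSlice D Y) (h : Hom f g),
        hom0 (E f g h) = h /\ hom2 (E f g h) = square_hom hD hS h (J f) (J g).

(* Main.v *)
(** Write [Id(y)] for the path object of [Y -> 1].  Pulling its source map back
    along [f : X -> Y] factors [f], functorially in [C/Y], as
    [lam : X -> M f] with the left lifting property against [D], followed by a
    display map [M f -> Y].  Hence a map [f] in the closure of [D] is a retract over
    [Y] of the display map [M f -> Y], with section [lam] natural in [f] although
    the retraction [σ] need not be.  Splitting idempotents transports pullbacks and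
    dependent products from display maps to their retracts.  The identity type of
    [f] is the pullback of [Id(M f)] along [lam × lam], so it is functorial; that
    its reflexivity map has the lifting property only requires the existence of
    some [σ], because [lam ∘ σ] is homotopic to the identity relative to [X]. *)

From Corelib Require Import ssreflect ssrfun.
From Stdlib Require Import ClassicalEpsilon FunctionalExtensionality PropExtensionality.
Require Import Defs.

Set Implicit Arguments.
Unset Strict Implicit.
Unset Printing Implicit Defensive.

(** * Extensionality, choice and generalities on pullbacks *)

Lemma eqclass_eq (C : Category) (M N : MorClass C) : eqclass M N -> M = N.
Proof.
move=> e; do 3 (apply: functional_extensionality_dep => ?).
exact: propositional_extensionality.
Qed.

(** Pullbacks are only asserted to exist, whereas a functor on a slice requires one for every object
    at once. *)
Lemma inhabited_dep_choice (A : Type) (B : A -> Type) :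
  (forall a, inhabited (B a)) -> inhabited (forall a, B a).
Proof.
move=> h; exact: (inhabits (fun a => epsilon (h a) (fun _ => True))).
Qed.

Lemma comp_reassoc (C : Category) (W X Y Z : C) (g : Hom Y Z) (f : Hom X Y)
    (h : Hom X Z) (e : g ∘ f = h) (k : Hom W X) :
  g ∘ (f ∘ k) = h ∘ k.
Proof. by rewrite comp_assoc e. Qed.

Lemma pb_lift_ex (C : Category) (A B Y : C) (f : Hom A Y) (g : Hom B Y)
    (P : Pullback f g) (Z : C) (u : Hom Z A) (v : Hom Z B) :
  f ∘ u = g ∘ v -> exists w : Hom Z P, pr1 P ∘ w = u /\ pr2 P ∘ w = v.
Proof.
move=> e; exists (pb_lift P e); split; [exact: pb_lift1 | exact: pb_lift2].
Qed.

Definition pb_swap (C : Category) (A B Y : C) (f : Hom A Y) (g : Hom B Y)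
    (P : Pullback f g) : Pullback g f :=
  Build_Pullback (esym (pb_comm P))
    (fun Z u v e => pb_lift2 P (esym e)) (fun Z u v e => pb_lift1 P (esym e))
    (fun Z w w' e e' => pb_uniq e' e).

Lemma diagonal1 (C : Category) (X Y : C) (f : Hom X Y) (P : Pullback f f) :
  pr1 P ∘ diagonal P = idm X.
Proof. exact: pb_lift1. Qed.

Lemma diagonal2 (C : Category) (X Y : C) (f : Hom X Y) (P : Pullback f f) :
  pr2 P ∘ diagonal P = idm X.
Proof. exact: pb_lift2. Qed.

(** * Lifting classes and the closure operator *)

Section LiftingClasses.
Variable C : Category.
Implicit Type M : MorClass C.

Lemma rlp_iso M (X Y : C) (f : Hom X Y) : is_iso f -> rlp M f.
Proof.
case=> g [gf fg] A B l _ u v e; exists (g ∘ v); split.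
- by rewrite -comp_assoc -e comp_assoc gf comp_id_l.
- by rewrite comp_assoc fg comp_id_l.
Qed.

Lemma rlp_comp M (X Y Z : C) (g : Hom Y Z) (f : Hom X Y) :
  rlp M f -> rlp M g -> rlp M (g ∘ f).
Proof.
move=> hf hg A B l hl u v e.
have [d [d1 d2]] := hg A B l hl (f ∘ u) v (etrans (comp_assoc g f u) e).
have [d' [d1' d2']] := hf A B l hl u d (esym d1).
by exists d'; rewrite -comp_assoc d2'.
Qed.

Lemma rlp_pullback M (X Y Z : C) (f : Hom X Y) (g : Hom Z Y) (P : Pullback g f) :
  rlp M f -> rlp M (pr1 P).
Proof.
move=> hf A B l hl u v e.
have [|d [d1 d2]] := hf A B l hl (pr2 P ∘ u) (g ∘ v).
  by rewrite comp_assoc -(pb_comm P) -!comp_assoc e.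
have [w [w1 w2]] := pb_lift_ex P (esym d2).
exists w; split=> //; apply: pb_uniq.
- by rewrite comp_assoc w1 e.
- by rewrite comp_assoc w2 d1.
Qed.

Lemma rlp_retract M (X X' Y : C) (f : Hom X Y) (f' : Hom X' Y)
    (i : Hom X X') (q : Hom X' X) :
  q ∘ i = idm X -> f ∘ q = f' -> rlp M f' -> rlp M f.
Proof.
move=> qi fq hf' A B l hl u v e.
have [|d [d1 d2]] := hf' A B l hl (i ∘ u) v.
  by rewrite -fq -comp_assoc (comp_reassoc qi) comp_id_l.
exists (q ∘ d); split.
- by rewrite -comp_assoc d1 (comp_reassoc qi) comp_id_l.
- by rewrite comp_assoc fq.
Qed.

(** [B] is a retract of [B'] under [A]; fillers for [l'] restrict along [j]. *)
Lemma llp_retract M (A B B' : C) (l : Hom A B) (l' : Hom A B')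
    (j : Hom B B') (k : Hom B' B) :
  k ∘ j = idm B -> j ∘ l = l' -> llp M l' -> llp M l.
Proof.
move=> kj jl hl' X Y r hr u v e.
have [|d [d1 d2]] := hl' X Y r hr u (v ∘ k).
  by rewrite -jl -comp_assoc (comp_reassoc kj) comp_id_l.
exists (d ∘ j); split.
- by rewrite -comp_assoc jl.
- by rewrite comp_assoc d2 -comp_assoc kj comp_id_r.
Qed.

Lemma subclass_closure M : subclass M (closure M).
Proof. by move=> X Y f hf A B l hl; apply: hl. Qed.

Lemma llp_closure M (A B : C) (l : Hom A B) : llp M l -> llp (closure M) l.
Proof. by move=> hl X Y r hr; apply: hr. Qed.

(** Holds because [L] is [llp R] and [R] is [rlp L]. *)
Lemma wfs_closure (L R : MorClass C) :
  weak_factorization_system L R -> eqclass (closure R) R.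
Proof.
case=> hL [hR _] X Y f; split=> [hf | ]; last exact: subclass_closure.
by apply/hR => A B l /hL; apply: hf.
Qed.

End LiftingClasses.

(** * Path objects and the mapping path factorization *)

Section PathFactorization.
Variables (C : Category) (D : MorClass C).
Hypotheses (hD : display_map_category D) (hS : models_Sigma D).

Section PathObject.
Variables (Y T : C) (y : Hom Y T) (J : id_type D y) (hy : D y).

Let src := pr1 (id_sq J) ∘ id_ε J.
Let tgt := pr2 (id_sq J) ∘ id_ε J.

Lemma id_src_display : D src.
Proof. exact: hS (id_ε_display J) (dm_stable hD _ hy). Qed.

(* The mapping path object is the pullback of [id_ε J : Id(Y) -> Y × Y] along
   [f × 1 : X × Y -> Y × Y], hence display over [X × Y], which is display over
   [Y]. *)
Lemma path_proj_display (X : C) (x : Hom X T) (f : Hom X Y) (Q : Pullback f src) :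
  D x -> y ∘ f = x -> D (tgt ∘ pr2 Q).
Proof.
move=> hx yf.
have [P] := dm_pullback hD y hx.
have [|fy [fy1 fy2]] := pb_lift_ex (id_sq J) (u := f ∘ pr2 P) (v := pr1 P).
  by rewrite comp_assoc yf (pb_comm P).
have [|q [q1 q2]] := pb_lift_ex P (u := tgt ∘ pr2 Q) (v := pr1 Q).
  rewrite /tgt !comp_assoc -(pb_comm (id_sq J)) -yf -!comp_assoc.
  by rewrite (pb_comm Q) /src -!comp_assoc.
(* [tgt ∘ pr2 Q] is [q] followed by [pr1 P], a base change of [x]; it remains to exhibit [q] as a
   base change of [id_ε J]. *)
suff hq : D q by rewrite -q1; exact: hS hq (dm_stable hD _ hx).
have sq : fy ∘ q = id_ε J ∘ pr2 Q.
{ apply: pb_uniq; rewrite !comp_assoc.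
  - by rewrite fy1 -comp_assoc q2 (pb_comm Q).
  - by rewrite fy2 q1. }
have lift1 Z (u : Hom Z P) (v : Hom Z (id_ob J)) :
    fy ∘ u = id_ε J ∘ v -> f ∘ (pr2 P ∘ u) = src ∘ v.
  by move=> e; rewrite /src -comp_assoc -e !comp_assoc fy1.
pose lift Z u v e := pb_lift Q (lift1 Z u v e).
have e1 Z u v e : q ∘ lift Z u v e = u.
{ apply: pb_uniq; rewrite comp_assoc.
  - by rewrite q1 -comp_assoc /lift pb_lift2 /tgt -comp_assoc -e comp_assoc fy2.
  - by rewrite q2 /lift pb_lift1. }
have e2 Z u v e : pr2 Q ∘ lift Z u v e = v by apply: pb_lift2.
have uniq Z (w w' : Hom Z Q) : q ∘ w = q ∘ w' -> pr2 Q ∘ w = pr2 Q ∘ w' -> w = w'.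
  by move=> h1 h2; apply: pb_uniq => //; rewrite -q2 -!comp_assoc h1.
exact: (dm_stable hD (Build_Pullback sq e1 e2 uniq) (id_ε_display J)).
Qed.

End PathObject.

Hypothesis hI : models_Id D.

(** A point of [M f] is a point of the domain of [f] with a path in [Y] starting at its image; [lam]
    attaches the constant path. [M1] moves the point and keeps the path, so it is strictly
    functorial. All of [C/Y] is allowed as source because maps into a terminal object are
    display. *)
Lemma functorial_path_factorization (Y : C) :
  exists (M : Slice Y -> DSlice D Y) (lam : forall f, Hom f (proj1_sig (M f)))
    (M1 : forall f g : Slice Y, Hom f g -> Hom (M f) (M g)),
    is_functor M1 /\
    (forall f, llp D (under (lam f))) /\
    (forall (f g : Slice Y) (h : Hom f g),
       under (M1 f g h) ∘ under (lam f) = under (lam g) ∘ under h).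
Proof.
have [T hT] := dm_has_terminal hD.
have [y _] := hT Y.
have hy : D y := dm_terminal hD y hT.
have [J] := hI hy.
pose src := pr1 (id_sq J) ∘ id_ε J; pose tgt := pr2 (id_sq J) ∘ id_ε J.
have [Q] : inhabited (forall f : Slice Y, Pullback (str f) src).
  by apply: inhabited_dep_choice => f; apply: dm_pullback (id_src_display J hy).
have hQ (f : Slice Y) : D (tgt ∘ pr2 (Q f)).
  exact: (path_proj_display (x := y ∘ str f) _ (dm_terminal hD _ hT)).
pose M (f : Slice Y) : DSlice D Y :=
  exist (display_over D (Y := Y)) (Over (tgt ∘ pr2 (Q f))) (hQ f).
pose l (f : Slice Y) : Hom (dom f) (Q f) :=
  pb_map (pb_id (str f)) (Q f) (comp_id_r (str f)) (id_refl_subproof false (id_fact J)).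
have l1 f : pr1 (Q f) ∘ l f = idm _ by rewrite /l pb_lift1 /= comp_id_l.
have l2 f : pr2 (Q f) ∘ l f = id_r J ∘ str f by rewrite /l pb_lift2.
have hl f : str (proj1_sig (M f)) ∘ l f = str f.
  rewrite /= -comp_assoc l2 comp_assoc (id_refl_subproof true (id_fact J)).
  exact: comp_id_l.
pose m (f g : Slice Y) (h : slice_hom f g) : Hom (Q f) (Q g) :=
  pb_map (Q f) (Q g) (under_str h) (comp_id_r src).
have m1 f g h : pr1 (Q g) ∘ m f g h = under h ∘ pr1 (Q f) by rewrite /m pb_lift1.
have m2 f g h : pr2 (Q g) ∘ m f g h = pr2 (Q f) by rewrite /m pb_lift2 comp_id_l.
have hm f g h : str (proj1_sig (M g)) ∘ m f g h = str (proj1_sig (M f)).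
  by rewrite /= -comp_assoc m2.
exists M, (fun f => @OverHom C Y f (proj1_sig (M f)) (l f) (hl f)).
exists (fun f g h => @OverHom C Y (proj1_sig (M f)) (proj1_sig (M g)) (m f g h) (hm f g h)).
split; [split | split].
- move=> f; apply: slice_hom_eq; apply: pb_uniq => /=.
  + by rewrite m1 /= comp_id_l comp_id_r.
  + by rewrite m2 comp_id_r.
- move=> f g k b a; apply: slice_hom_eq; apply: pb_uniq => /=.
  + by rewrite m1 comp_assoc m1 -comp_assoc m1 comp_assoc.
  + by rewrite m2 comp_assoc !m2.
(* [l f] is by construction the map [α^*r] with [α = str f] and [i = 0]. *)
- move=> f; exact: (id_r_lifting (i := false)).
- move=> f g h; apply: pb_uniq => /=.
  + by rewrite !comp_assoc m1 l1 -comp_assoc l1 comp_id_r comp_id_l.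
  + by rewrite !comp_assoc m2 !l2 -comp_assoc under_str.
Qed.

(** A diagonal of the square from [l] to [f] whose top is the identity of [X] and whose bottom is
    [p]. *)
Lemma closure_retraction (X M Y : C) (f : Hom X Y) (l : Hom X M) (p : Hom M Y) :
  closure D f -> llp D l -> p ∘ l = f ->
  exists s : Hom M X, s ∘ l = idm X /\ f ∘ s = p.
Proof.
by move=> hf hl e; apply: (hf _ _ l hl); rewrite comp_id_r.
Qed.

Lemma closure_is_retract (X Y : C) (f : Hom X Y) :
  closure D f -> exists (M : C) (p : Hom M Y) (l : Hom X M) (s : Hom M X),
    D p /\ s ∘ l = idm X /\ f ∘ s = p /\ p ∘ l = f.
Proof.
move=> hf; have [M [l [_ [_ [hl _]]]]] := functorial_path_factorization Y.
have [s [s1 s2]] := closure_retraction hf (hl (Over f)) (under_str (l (Over f))).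
exists _, (str (proj1_sig (M (Over f)))), (under (l (Over f))), s.
split; first exact: (proj2_sig (M (Over f))).
by split=> //; split=> //; apply: (under_str (l (Over f))).
Qed.

(** * Pullbacks of maps in the closure by splitting idempotents *)

Hypothesis hC : Cauchy_complete C.

(** The idempotent [l ∘ s] of [M] over [Y] splits through [X]; its base change along [g] is an
    idempotent [e] of [P], whose splitting is the pullback of [f]. *)
Lemma closure_pullback (X Y Z : C) (f : Hom X Y) (g : Hom Z Y) :
  closure D f -> inhabited (Pullback g f).
Proof.
move=> /closure_is_retract [M [p [l [s [hp [sl [fs pl]]]]]]].
have [P] := dm_pullback hD g hp.
have [|e [e1 e2]] := pb_lift_ex P (u := pr1 P) (v := l ∘ (s ∘ pr2 P)).
  by rewrite (pb_comm P) !comp_assoc pl fs.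
have [|S [r [i [ir ri]]]] := hC (e := e).
{ apply: pb_uniq; rewrite comp_assoc.
  - by rewrite e1.
  - by rewrite e2 -!comp_assoc e2 (comp_reassoc sl) comp_id_l. }
have ei : e ∘ i = i by rewrite -ir -comp_assoc ri comp_id_r.
have re : r ∘ e = r by rewrite -ir comp_assoc ri comp_id_l.
have lift1 W (u : Hom W Z) (v : Hom W X) : g ∘ u = f ∘ v -> g ∘ u = p ∘ (l ∘ v).
  by rewrite comp_assoc pl.
constructor.
unshelve eexists S (pr1 P ∘ i) (s ∘ (pr2 P ∘ i))
  (fun W u v h => r ∘ pb_lift P (lift1 W u v h)).
- by rewrite !comp_assoc fs (pb_comm P).
- move=> W u v h; rewrite -comp_assoc (comp_assoc i) ir comp_assoc e1; exact: pb_lift1.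
- move=> W u v h; rewrite -!comp_assoc (comp_assoc i) ir (comp_assoc _ e) e2 -!comp_assoc.
  by rewrite pb_lift2 !(comp_reassoc sl) !comp_id_l.
- move=> W w w' h1 h2.
  suff h : i ∘ w = i ∘ w' by rewrite -(comp_id_l w) -ri -comp_assoc h
    comp_assoc ri comp_id_l.
  (* Inserting [e] makes the second component factor through [s ∘ pr2 P], which [h2] controls. *)
  rewrite -ei -!comp_assoc; apply: pb_uniq.
  + by rewrite !(comp_reassoc e1) !comp_assoc.
  + by rewrite !(comp_reassoc e2) -!comp_assoc; congr (_ ∘ _); move: h2;
      rewrite -!comp_assoc.
Qed.

Lemma closure_display_map_category : display_map_category (closure D).
Proof.
split.
- exact: dm_has_terminal hD.
- by move=> *; apply: rlp_iso.
- by move=> X T f hT; apply: subclass_closure; apply: (dm_terminal hD f hT).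
- by move=> *; apply: closure_pullback.
- by move=> *; apply: rlp_pullback.
Qed.

Lemma closure_models_Sigma : models_Sigma (closure D).
Proof. by move=> *; apply: rlp_comp. Qed.

End PathFactorization.

(** * Reflexivity for a path object restricted to a retract *)

Section RetractPathObject.
Variables (C : Category) (N : MorClass C).
Variables (X M Y I I' : C) (f : Hom X Y) (p : Hom M Y).
Variables (r : Hom M I) (s t : Hom I M).
Hypotheses (sr : s ∘ r = idm M) (tr : t ∘ r = idm M) (pst : p ∘ s = p ∘ t).
Hypothesis path_lift : forall (A B : C) (l : Hom A B) (u : Hom A I) (v w : Hom B M),
  llp N l -> p ∘ v = p ∘ w -> s ∘ u = v ∘ l -> t ∘ u = w ∘ l ->
  exists d : Hom B I, d ∘ l = u /\ s ∘ d = v /\ t ∘ d = w.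
Hypothesis path_pullback : forall (A : C) (α : Hom A M), inhabited (Pullback α s).
Hypothesis refl_llp : forall (A : C) (α : Hom A M) (Q : Pullback α s) (l : Hom A Q),
  pr1 Q ∘ l = idm A -> pr2 Q ∘ l = r ∘ α -> llp N l.
Variables (lam : Hom X M) (σ : Hom M X).
Hypotheses (lam_llp : llp N lam) (σlam : σ ∘ lam = idm X) (fσ : f ∘ σ = p).

(** Composition of paths: [P] consists of composable pairs, and [c] extends the identity of [I]
    along the map [l] that appends a constant path. Hence [c] is strictly unital on the right. *)
Lemma path_composition (P : Pullback t s) :
  exists c : Hom P I, s ∘ c = s ∘ pr1 P /\ t ∘ c = t ∘ pr2 P /\
    forall (A : C) (w : Hom A P), pr2 P ∘ w = r ∘ (t ∘ (pr1 P ∘ w)) ->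
      c ∘ w = pr1 P ∘ w.
Proof.
have [|l [l1 l2]] := pb_lift_ex P (u := idm I) (v := r ∘ t).
  by rewrite comp_id_r comp_assoc sr comp_id_l.
have hl : llp N l by apply: refl_llp l1 l2.
have [| | |c [c1 [c2 c3]]] :=
    path_lift (u := idm I) (v := s ∘ pr1 P) (w := t ∘ pr2 P) hl.
  by rewrite comp_assoc pst -comp_assoc (pb_comm P) !comp_assoc pst.
  by rewrite -comp_assoc l1.
  by rewrite -comp_assoc l2 comp_assoc tr comp_id_l comp_id_r.
exists c; split=> //; split=> // A w e.
(* The second path of [w] is constant, so [w] factors through [l]. *)
suff lw : l ∘ (pr1 P ∘ w) = w by rewrite -{1}lw (comp_reassoc c1) comp_id_l.
apply: pb_uniq; rewrite comp_assoc.
- by rewrite l1 comp_id_l.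
- by rewrite l2 -comp_assoc e.
Qed.

(** The identity and [lam ∘ σ] agree along [lam], so the constant path there extends over [M] to a
    path between them. *)
Lemma retract_homotopy :
  exists H : Hom M I, H ∘ lam = r ∘ lam /\ s ∘ H = idm M /\ t ∘ H = lam ∘ σ.
Proof.
have plam : p ∘ lam = f by rewrite -fσ -comp_assoc σlam comp_id_r.
apply: path_lift lam_llp _ _ _.
- by rewrite comp_id_r comp_assoc plam.
- by rewrite comp_assoc sr.
- by rewrite comp_assoc tr -comp_assoc σlam comp_id_l comp_id_r.
Qed.

Variables (s' t' : Hom I' X) (j : Hom I' I).
Hypotheses (sj : s ∘ j = lam ∘ s') (tj : t ∘ j = lam ∘ t').
Hypothesis j_lift : forall (Z : C) (u v : Hom Z X) (w : Hom Z I),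
  f ∘ u = f ∘ v -> s ∘ w = lam ∘ u -> t ∘ w = lam ∘ v ->
  exists k : Hom Z I', s' ∘ k = u /\ t' ∘ k = v /\ j ∘ k = w.
Hypothesis j_uniq : forall (Z : C) (k k' : Hom Z I'),
  s' ∘ k = s' ∘ k' -> t' ∘ k = t' ∘ k' -> j ∘ k = j ∘ k' -> k = k'.

(* A path [q : lam (α a) -> m] is sent to the composite of [q] with the homotopy
   [m -> lam (σ m)], giving a path between points of [X]; composition is strictly
   unital on the right and the homotopy is constant on [X], so that this retracts
   [α^*I'] off [(lam ∘ α)^*I]. *)
Lemma retract_refl_llp (A : C) (α : Hom A X) (Q' : Pullback α s') (l : Hom A Q') :
  pr1 Q' ∘ l = idm A -> j ∘ (pr2 Q' ∘ l) = r ∘ (lam ∘ α) -> llp N l.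
Proof.
move=> l1 l2.
have plam : p ∘ lam = f by rewrite -fσ -comp_assoc σlam comp_id_r.
have [Q] := path_pullback (lam ∘ α).
have [P] := path_pullback t.
have [c [sc [tc cr]]] := path_composition P.
have [H [Hlam [sH tH]]] := retract_homotopy.
(* [ι] includes [α^*I'] into [(lam ∘ α)^*I]; [κ] below is its retraction. *)
have [|ι [ι1 ι2]] := pb_lift_ex Q (u := pr1 Q') (v := j ∘ pr2 Q').
  by rewrite -comp_assoc (pb_comm Q') !comp_assoc sj.
have [|pH [pH1 pH2]] := pb_lift_ex P (u := pr2 Q) (v := H ∘ (t ∘ pr2 Q)).
  by rewrite comp_assoc sH comp_id_l.
(* The composite path runs from [lam (α a)] to [lam (σ m)], so it comes from [I']. *)
have [| | |k [k1 [k2 k3]]] :=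
    j_lift (u := α ∘ pr1 Q) (v := σ ∘ (t ∘ pr2 Q)) (w := c ∘ pH).
  rewrite (comp_reassoc fσ) [RHS]comp_assoc -pst -comp_assoc -(pb_comm Q).
  by rewrite !comp_assoc plam.
  by rewrite comp_assoc sc -comp_assoc pH1 -(pb_comm Q) comp_assoc.
  by rewrite comp_assoc tc -comp_assoc pH2 comp_assoc tH -comp_assoc.
have [κ [κ1 κ2]] := pb_lift_ex Q' (esym k1).
have tι : t ∘ (pr2 Q ∘ ι) = lam ∘ (t' ∘ pr2 Q') by rewrite ι2 !comp_assoc tj.
apply: (llp_retract (l' := ι ∘ l) (j := ι) (k := κ)) => //.
- apply: pb_uniq; rewrite comp_id_r comp_assoc; first by rewrite κ1.
  rewrite κ2; apply: j_uniq; rewrite comp_assoc.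
  + by rewrite k1 -comp_assoc ι1 (pb_comm Q').
  + by rewrite k2 -!comp_assoc tι comp_assoc σlam comp_id_l.
  (* On the image of [ι] the path ends in [X], where [H] is constant, so the right unit law [cr]
     applies. *)
  + rewrite k3 -comp_assoc cr; last by rewrite (comp_reassoc pH1) ι2.
    rewrite (comp_reassoc pH1) (comp_reassoc pH2) -!comp_assoc tι.
    by rewrite !(comp_reassoc Hlam) -!comp_assoc.
- apply: refl_llp.
  + by rewrite comp_assoc ι1.
  + by rewrite comp_assoc ι2 -comp_assoc.
Qed.

End RetractPathObject.

(** A pulled-back reflexivity map is determined by its two components, which is the form assumed in
    the abstract argument above. *)
Lemma id_r_llp (C : Category) (D : MorClass C) (X Y : C) (f : Hom X Y)
    (J : id_type D f) (i : bool) (A : C) (α : Hom A X)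
    (Q : Pullback α ((if i then pr2 (id_sq J) else pr1 (id_sq J)) ∘ id_ε J))
    (l : Hom A Q) :
  pr1 Q ∘ l = idm A -> pr2 Q ∘ l = id_r J ∘ α -> llp D l.
Proof.
move=> l1 l2.
have -> : l = pb_map (pb_id α) Q (comp_id_r α) (id_refl_subproof i (id_fact J)).
  by apply: pb_uniq; rewrite ?pb_lift1 ?pb_lift2 /= ?comp_id_l.
exact: id_r_lifting.
Qed.

(** * Identity types of maps in the closure *)

Section ClosureId.
Variables (C : Category) (D : MorClass C).
Hypotheses (hD : display_map_category D) (hS : models_Sigma D).
Variables (X M Y : C) (f : Hom X Y) (p : Hom M Y) (lam : Hom X M).
Hypotheses (hf : closure D f) (hp : D p) (hlam : llp D lam) (plam : p ∘ lam = f).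
Variables (K : id_type D p) (P : Pullback f f).
Variable Q : Pullback (pb_map P (id_sq K) plam plam) (id_ε K).

Lemma closure_id_r_subproof :
  pb_map P (id_sq K) plam plam ∘ diagonal P = id_ε K ∘ (id_r K ∘ lam).
Proof.
rewrite (comp_reassoc (id_fact K)).
by apply: pb_uniq; rewrite !comp_assoc ?pb_lift1 ?pb_lift2 -comp_assoc
  ?diagonal1 ?diagonal2 comp_id_l comp_id_r.
Qed.

Definition closure_id_r : Hom X Q := pb_lift Q closure_id_r_subproof.

Lemma closure_id_fact : pr1 Q ∘ closure_id_r = diagonal P.
Proof. exact: pb_lift1. Qed.

Lemma closure_id_ε_display : closure D (pr1 Q).
Proof. by apply: subclass_closure; exact: (dm_stable hD Q (id_ε_display K)). Qed.

(** [D] and its closure have the same left class, so lifting against [D] suffices. Endpoint [i]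
    serves as source and [negb i] as target in the retraction argument, which covers both values of
    [i]; any filler [σ] will do. *)
Lemma closure_id_r_lifting (A : C) (α : Hom A X) (i : bool)
    (T : Pullback α ((if i then pr2 P else pr1 P) ∘ pr1 Q)) :
  llp (closure D)
    (pb_map (pb_id α) T (comp_id_r α) (id_refl_subproof i closure_id_fact)).
Proof.
apply: llp_closure.
have [σ [σlam fσ]] := closure_retraction hf hlam plam.
pose end_ (b : bool) := (if b then pr2 (id_sq K) else pr1 (id_sq K)) ∘ id_ε K.
pose end' (b : bool) := (if b then pr2 P else pr1 P) ∘ pr1 Q.
have [P1 P2] : D (pr1 (id_sq K)) /\ D (pr2 (id_sq K)).
  by split; [exact: (dm_stable hD (id_sq K) hp)
    | exact: (dm_stable hD (pb_swap (id_sq K)) hp)].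
apply: (@retract_refl_llp C D X M Y (id_ob K) Q f p (id_r K) (end_ i) (end_ (negb i))
  _ _ _ _ _ _ lam σ hlam σlam fσ (end' i) (end' (negb i)) (pr2 Q)).
- exact: id_refl_subproof (id_fact K).
- exact: id_refl_subproof (id_fact K).
- by case: i {T}; rewrite /end_ !comp_assoc (pb_comm (id_sq K)).
- move=> A' B' l u v w hl e.
  (* Proved for [i = 0]; the other order follows by exchanging [v] and [w]. *)
  have lift v' w' : p ∘ v' = p ∘ w' -> pr1 (id_sq K) ∘ id_ε K ∘ u = v' ∘ l ->
      pr2 (id_sq K) ∘ id_ε K ∘ u = w' ∘ l -> exists d : Hom B' (id_ob K),
      d ∘ l = u /\ pr1 (id_sq K) ∘ id_ε K ∘ d = v' /\
      pr2 (id_sq K) ∘ id_ε K ∘ d = w'.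
  { move=> /(pb_lift_ex (id_sq K)) [z [z1 z2]] e1 e2.
    have [|d [d1 d2]] := hl _ _ _ (id_ε_display K) u z.
      by apply: pb_uniq; rewrite !comp_assoc ?e1 ?e2 ?z1 ?z2.
    by exists d; rewrite -!comp_assoc d2. }
  case: i {T} => /= e1 e2; last exact: lift.
  by have [d [? [? ?]]] := lift w v (esym e) e2 e1; exists d.
- move=> A' β; apply: (dm_pullback hD); apply: hS (id_ε_display K) _.
  by case: i {T}.
- by move=> A' β T' l; apply: id_r_llp.
- by case: i {T}; rewrite /end_ /end' /= -!comp_assoc -(pb_comm Q) !comp_assoc
    ?pb_lift1 ?pb_lift2.
- by case: i {T}; rewrite /end_ /end' /= -!comp_assoc -(pb_comm Q) !comp_assoc
    ?pb_lift1 ?pb_lift2.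
- move=> Z u v w e e1 e2.
  (* A point of [Q] amounts to two points of [X] over the same point of [Y] and a path between their
     images in [M]. *)
  have lift u' v' : f ∘ u' = f ∘ v' -> pr1 (id_sq K) ∘ id_ε K ∘ w = lam ∘ u' ->
      pr2 (id_sq K) ∘ id_ε K ∘ w = lam ∘ v' -> exists k : Hom Z Q,
      pr1 P ∘ pr1 Q ∘ k = u' /\ pr2 P ∘ pr1 Q ∘ k = v' /\ pr2 Q ∘ k = w.
  { move=> /(pb_lift_ex P) [z [z1 z2]] e3 e4.
    have [|k [k1 k2]] := pb_lift_ex Q (u := z) (v := w).
      by apply: pb_uniq; rewrite !comp_assoc ?pb_lift1 ?pb_lift2 -comp_assoc ?z1 ?z2.
    by exists k; rewrite -!comp_assoc k1. }
  case: i {T} e1 e2 => /= e1 e2; last exact: lift.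
  by have [k [? [? ?]]] := lift v u (esym e) e2 e1; exists k.
- move=> Z k k' e1 e2 e3; apply: pb_uniq => //.
  by case: i {T} e1 e2 => /= e1 e2; apply: pb_uniq; rewrite !comp_assoc.
- by rewrite pb_lift1 /= comp_id_l.
- rewrite pb_lift2 /= [LHS]comp_assoc pb_lift2 -comp_assoc //.
Qed.

Definition closure_id_type : id_type (closure D) f :=
  Build_id_type closure_id_ε_display closure_id_r_lifting.
End ClosureId.

(** * Functoriality of the identity types *)

Section FunctorialId.
Variables (C : Category) (D : MorClass C).
Hypotheses (hD : display_map_category D) (hS : models_Sigma D).
Hypotheses (hR : display_map_category (closure D)) (hSR : models_Sigma (closure D)).
Variable Y : C.
Variables (M : Slice Y -> DSlice D Y) (lam : forall f, Hom f (proj1_sig (M f))).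
Variable M1 : forall f g : Slice Y, Hom f g -> Hom (M f) (M g).
Hypothesis M_functor : is_functor (@M1).
Hypothesis lam_llp : forall f, llp D (under (lam f)).
Hypothesis lam_natural : forall (f g : Slice Y) (h : Hom f g),
  under (M1 h) ∘ under (lam f) = under (lam g) ∘ under h.
Variables (K : forall f : DSlice D Y, id_type D (str (proj1_sig f)))
  (E : forall f g : DSlice D Y, Hom f g ->
     Hom (id_pair hD hS (K f)) (id_pair hD hS (K g))).
Hypothesis E_functor : is_functor (@E).
Hypothesis E_outer : forall (f g : DSlice D Y) (h : Hom f g),
  hom0 (E h) = h /\ hom2 (E h) = square_hom hD hS h (K f) (K g).

Local Notation RY := (DSlice (closure D) Y).
Local Notation Mr f := (M (proj1_sig f)).
Local Notation lamr f := (under (lam (proj1_sig f))).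

Variable P : forall f : RY, Pullback (str (proj1_sig f)) (str (proj1_sig f)).

Definition lam_square (f : RY) : Hom (P f) (id_sq (K (Mr f))) :=
  pb_map (P f) (id_sq (K (Mr f))) (under_str (lam (proj1_sig f)))
    (under_str (lam (proj1_sig f))).

Variable Q : forall f : RY, Pullback (lam_square f) (id_ε (K (Mr f))).

Definition closure_id (f : RY) : id_type (closure D) (str (proj1_sig f)) :=
  closure_id_type hD hS (proj2_sig f) (proj2_sig (Mr f)) (@lam_llp (proj1_sig f)) (Q f).

Local Notation J := closure_id.

Definition mid_hom (f g : DSlice D Y) (h : Hom f g) : Hom (id_ob (K f)) (id_ob (K g)) :=
  under (hom1 (E h)).

Lemma mid_hom_r (f g : DSlice D Y) (h : Hom f g) :
  mid_hom h ∘ id_r (K f) = id_r (K g) ∘ under h.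
Proof.
have := f_equal (@under _ _ _ _) (hom_sq01 (E h)).
by rewrite (proj1 (E_outer h)).
Qed.

Lemma mid_hom_ε (f g : DSlice D Y) (h : Hom f g) :
  id_ε (K g) ∘ mid_hom h = under (square_hom hD hS h (K f) (K g)) ∘ id_ε (K f).
Proof.
have := f_equal (@under _ _ _ _) (hom_sq12 (E h)).
by rewrite (proj2 (E_outer h)) => /esym.
Qed.

Definition base_square_hom (f g : RY) (h : Hom f g) : Hom (P f) (P g) :=
  pb_map (P f) (P g) (under_str h) (under_str h).

(** Naturality of [lam] in each factor; this square is what lets the action on paths pass to the
    pullbacks [Q]. *)
Lemma lam_square_natural (f g : RY) (h : Hom f g) :
  lam_square g ∘ base_square_hom h =
    under (square_hom hD hS (M1 h) (K _) (K _)) ∘ lam_square f.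
Proof.
apply: pb_uniq; rewrite !comp_assoc ?pb_lift1 ?pb_lift2 -!comp_assoc ?pb_lift1 ?pb_lift2;
  rewrite !comp_assoc; congr (_ ∘ _); exact/esym/lam_natural.
Qed.

Lemma closure_mid_subproof (f g : RY) (h : Hom f g) :
  lam_square g ∘ (base_square_hom h ∘ pr1 (Q f)) =
    id_ε (K (Mr g)) ∘ (mid_hom (M1 h) ∘ pr2 (Q f)).
Proof.
by rewrite comp_assoc lam_square_natural -comp_assoc (pb_comm (Q f)) !comp_assoc mid_hom_ε.
Qed.

(** This is [h × h] on endpoints and the given action of [M1 h] on paths in [M]. *)
Definition closure_mid (f g : RY) (h : Hom f g) : Hom (Q f) (Q g) :=
  pb_lift (Q g) (closure_mid_subproof h).

Lemma closure_mid1 (f g : RY) (h : Hom f g) :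
  pr1 (Q g) ∘ closure_mid h = base_square_hom h ∘ pr1 (Q f).
Proof. exact: pb_lift1. Qed.

Lemma closure_mid2 (f g : RY) (h : Hom f g) :
  pr2 (Q g) ∘ closure_mid h = mid_hom (M1 h) ∘ pr2 (Q f).
Proof. exact: pb_lift2. Qed.

Lemma closure_mid_str (f g : RY) (h : Hom f g) :
  str (proj1_sig (id_iota hR hSR (J g))) ∘ closure_mid h =
    str (proj1_sig (id_iota hR hSR (J f))).
Proof.
rewrite /= -!comp_assoc closure_mid1 (comp_assoc (pr1 (P g))) pb_lift1 !comp_assoc.
by rewrite under_str.
Qed.

Definition closure_mid_over (f g : RY) (h : Hom f g) :
    Hom (id_iota hR hSR (J f)) (id_iota hR hSR (J g)) :=
  @OverHom C Y (proj1_sig (id_iota hR hSR (J f))) (proj1_sig (id_iota hR hSR (J g)))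
    (closure_mid h) (closure_mid_str h).

Lemma closure_mid_r (f g : RY) (h : Hom f g) :
  closure_mid_over h ∘ id_r_over hR hSR (J f) = id_r_over hR hSR (J g) ∘ h.
Proof.
apply: slice_hom_eq; apply: pb_uniq; rewrite /= /closure_id_r !comp_assoc.
- rewrite closure_mid1 pb_lift1 -comp_assoc pb_lift1.
  by apply: pb_uniq; rewrite !comp_assoc ?pb_lift1 ?pb_lift2 -comp_assoc
    ?diagonal1 ?diagonal2 comp_id_l comp_id_r.
- rewrite closure_mid2 -[LHS]comp_assoc !pb_lift2 comp_assoc mid_hom_r.
  by rewrite -!comp_assoc; congr (_ ∘ _); apply: lam_natural.
Qed.

Lemma closure_mid_ε (f g : RY) (h : Hom f g) :
  square_hom hR hSR h (J f) (J g) ∘ id_ε_over hR hSR (J f) =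
    id_ε_over hR hSR (J g) ∘ closure_mid_over h.
Proof. by apply: slice_hom_eq; rewrite /= closure_mid1. Qed.

Definition closure_id_hom (f g : RY) (h : Hom f g) :
    Hom (id_pair hR hSR (J f)) (id_pair hR hSR (J g)) :=
  @CPairHom _ (id_pair hR hSR (J f)) (id_pair hR hSR (J g))
    h (closure_mid_over h) (square_hom hR hSR h (J f) (J g))
    (closure_mid_r h) (closure_mid_ε h).

Lemma base_square_hom_id (f : RY) : base_square_hom (idm f) = idm (P f).
Proof.
by apply: pb_uniq; rewrite ?pb_lift1 ?pb_lift2 /= comp_id_l comp_id_r.
Qed.

Lemma base_square_hom_comp (f g k : RY) (b : Hom g k) (a : Hom f g) :
  base_square_hom (b ∘ a) = base_square_hom b ∘ base_square_hom a.
Proof.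
by apply: pb_uniq; rewrite [RHS]comp_assoc ?pb_lift1 ?pb_lift2 /= -!comp_assoc
  ?pb_lift1 ?pb_lift2.
Qed.

(** Maps into [Q] are determined by endpoints and path; the first are functorial by uniqueness, the
    second by composing the functors [M1] and [E]. *)
Lemma closure_id_functor : is_functor (@closure_id_hom).
Proof.
split=> [f | f g k b a]; apply: pair_hom_eq => //; apply: slice_hom_eq => /=.
- apply: pb_uniq; rewrite comp_id_r.
  + by rewrite closure_mid1 base_square_hom_id comp_id_l.
  + rewrite closure_mid2 /mid_hom (proj1 M_functor) (proj1 E_functor).
    exact: comp_id_l.
- exact: base_square_hom_id.
- apply: pb_uniq; rewrite [RHS]comp_assoc.
  + by rewrite !closure_mid1 -comp_assoc closure_mid1 base_square_hom_comp comp_assoc.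
  + rewrite !closure_mid2 -comp_assoc closure_mid2 /mid_hom.
    by rewrite (proj2 M_functor) (proj2 E_functor) comp_assoc.
- exact: base_square_hom_comp.
Qed.

End FunctorialId.

Lemma closure_models_functorial_Id (C : Category) (D : MorClass C)
    (hD : display_map_category D) (hS : models_Sigma D)
    (hR : display_map_category (closure D)) (hSR : models_Sigma (closure D)) :
  models_functorial_Id hD hS -> models_functorial_Id hR hSR.
Proof.
move=> [hI hF]; rewrite /models_functorial_Id.
(* [models_Id] follows from the functorial clause at the object [f] of the slice. *)
set fId := forall Y, _; suff hFR : fId.
  split=> // X Y f hf; have [J _] := hFR Y.
  exact: (inhabits (J (exist (display_over (closure D) (Y := Y)) (Over f) hf))).
move=> Y.
have [M [lam [M1 [hM [hlam lam_nat]]]]] := functorial_path_factorization hD hS hI Y.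
have [K [E [hE hE']]] := hF Y.
have [P] : inhabited (forall f : DSlice (closure D) Y,
    Pullback (str (proj1_sig f)) (str (proj1_sig f))).
  by apply: inhabited_dep_choice => f; exact: (dm_pullback hR _ (proj2_sig f)).
have [Q] : inhabited (forall f, Pullback (lam_square lam K P f) (id_ε (K (M (proj1_sig f))))).
  by apply: inhabited_dep_choice => f; exact: (dm_pullback hD _ (id_ε_display _)).
exists (closure_id hD hS hlam Q), (closure_id_hom hR hSR hlam lam_nat hE' Q).
by split=> //; exact: closure_id_functor.
Qed.

(** * Dependent products of maps in the closure *)

(* Both legs being retracts, the functor [y |-> C/X(f^*y, g)] is a natural retract
   of [y |-> C/M(p^*y, σ^*g')]: a map [h] is sent to [(y, m) |-> (m, i (h (y, σ m)))],
   and back by restriction along [lam]. *)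
Lemma pb_hom_retract (C : Category) (X M Y W W' : C) (f : Hom X Y) (p : Hom M Y)
    (lam : Hom X M) (σ : Hom M X) (g : Hom W X) (g' : Hom W' X)
    (i : Hom W W') (q : Hom W' W) (T : Pullback σ g') :
  σ ∘ lam = idm X -> f ∘ σ = p -> p ∘ lam = f ->
  q ∘ i = idm W -> g ∘ q = g' -> g' ∘ i = g ->
  exists (a : forall (y : Slice Y) (A : Pullback f (str y)) (B : Pullback p (str y)),
      @Hom (Slice X) (pb_obj A) (Over g) -> @Hom (Slice M) (pb_obj B) (Over (pr1 T)))
    (b : forall (y : Slice Y) (A : Pullback f (str y)) (B : Pullback p (str y)),
      @Hom (Slice M) (pb_obj B) (Over (pr1 T)) -> @Hom (Slice X) (pb_obj A) (Over g)),
    (forall y A B, cancel (a y A B) (b y A B)) /\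
    (forall y' y (u : Hom y' y) A' A B' B h,
       a y' A' B' (h ∘ pb_hom u A' A) = a y A B h ∘ pb_hom u B' B) /\
    (forall y' y (u : Hom y' y) A' A B' B k,
       b y' A' B' (k ∘ pb_hom u B' B) = b y A B k ∘ pb_hom u A' A).
Proof.
move=> σlam fσ plam qi gq g'i.
have fwd_sub (y : Slice Y) (A : Pullback f (str y)) : p ∘ (lam ∘ pr1 A) = str y ∘ pr2 A.
  by rewrite comp_assoc plam (pb_comm A).
have back_sub (y : Slice Y) (B : Pullback p (str y)) : f ∘ (σ ∘ pr1 B) = str y ∘ pr2 B.
  by rewrite comp_assoc fσ (pb_comm B).
(* Base changes of [lam] and [σ], presenting [f^*y] as a retract of [p^*y]. *)
pose fwd (y : Slice Y) (A : Pullback f (str y)) (B : Pullback p (str y)) :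
    Hom A B := pb_lift B (fwd_sub y A).
pose back (y : Slice Y) (A : Pullback f (str y)) (B : Pullback p (str y)) :
    Hom B A := pb_lift A (back_sub y B).
have fwd1 (y : Slice Y) (A : Pullback f (str y)) (B : Pullback p (str y)) :
    pr1 B ∘ fwd y A B = lam ∘ pr1 A by apply: pb_lift1.
have fwd2 (y : Slice Y) (A : Pullback f (str y)) (B : Pullback p (str y)) :
    pr2 B ∘ fwd y A B = pr2 A by apply: pb_lift2.
have back1 (y : Slice Y) (A : Pullback f (str y)) (B : Pullback p (str y)) :
    pr1 A ∘ back y A B = σ ∘ pr1 B by apply: pb_lift1.
have back2 (y : Slice Y) (A : Pullback f (str y)) (B : Pullback p (str y)) :
    pr2 A ∘ back y A B = pr2 B by apply: pb_lift2.
have a_sub (y : Slice Y) (A : Pullback f (str y)) (B : Pullback p (str y))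
    (h : slice_hom (pb_obj A) (Over g)) :
    σ ∘ pr1 B = g' ∘ (i ∘ (under h ∘ back y A B)).
  by rewrite (comp_reassoc g'i) (comp_reassoc (under_str h)) back1.
have b_sub (y : Slice Y) (A : Pullback f (str y)) (B : Pullback p (str y))
    (k : slice_hom (pb_obj B) (Over (pr1 T))) :
    g ∘ (q ∘ (pr2 T ∘ (under k ∘ fwd y A B))) = pr1 A.
  rewrite (comp_reassoc gq) comp_assoc -(pb_comm T) -comp_assoc.
  by rewrite (comp_reassoc (under_str k)) fwd1 comp_assoc σlam comp_id_l.
exists (fun y A B h => @OverHom C M (pb_obj B) (Over (pr1 T))
  (pb_lift T (a_sub y A B h)) (pb_lift1 T (a_sub y A B h))).
exists (fun y A B k => @OverHom C X (pb_obj A) (Over g) _ (b_sub y A B k)).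
split; [|split].
- move=> y A B h; apply: slice_hom_eq => /=.
  rewrite (comp_assoc (pr2 T)) pb_lift2 -!comp_assoc (comp_reassoc qi) comp_id_l.
  suff -> : back y A B ∘ fwd y A B = idm A by rewrite comp_id_r.
  apply: pb_uniq; rewrite comp_assoc ?back1 ?back2 -?comp_assoc ?fwd1 ?fwd2 comp_id_r //.
  by rewrite comp_assoc σlam comp_id_l.
- move=> y' y u A' A B' B h; apply: slice_hom_eq; apply: pb_uniq => /=.
  + by rewrite pb_lift1 comp_assoc !pb_lift1 comp_id_l.
  + rewrite [RHS]comp_assoc !pb_lift2 -!comp_assoc.
    do 2 (congr (_ ∘ _)).
    by apply: pb_uniq; rewrite /pb_map !comp_assoc ?pb_lift1 ?pb_lift2 ?back1 ?back2
      -!comp_assoc ?pb_lift1 ?pb_lift2 ?back1 ?back2 ?comp_id_l.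
- move=> y' y u A' A B' B k; apply: slice_hom_eq => /=.
  rewrite -!comp_assoc; do 3 (congr (_ ∘ _)).
  by apply: pb_uniq; rewrite /pb_map !comp_assoc ?pb_lift1 ?pb_lift2 ?fwd1 ?fwd2
      -!comp_assoc ?pb_lift1 ?pb_lift2 ?fwd1 ?fwd2 ?comp_id_l.
Qed.

(** [V] represents a functor of which the one for [f] and [g] is a natural retract. By Yoneda the
    resulting idempotent transformation comes from an idempotent [e] of [V] over [Y], and the
    splitting of [e] represents the retract. *)
Lemma closure_models_Pi (C : Category) (D : MorClass C)
    (hD : display_map_category D) (hS : models_Sigma D) :
  Cauchy_complete C -> models_Id D -> models_Pi D -> models_Pi (closure D).
Proof.
move=> hC hI hP W X Y g f hg hf.
have [M [p [lam [σ [hp [σlam [fσ plam]]]]]]] := closure_is_retract hD hS hI hf.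
have [W' [g' [i [q [hg' [qi [gq g'i]]]]]]] := closure_is_retract hD hS hI hg.
have [T] := dm_pullback hD σ hg'.
have [a [b [aK [a_nat b_nat]]]] := pb_hom_retract T σlam fσ plam qi gq g'i.
have [V [v [hv [φ [φ_bij φ_nat]]]]] := hP _ _ _ _ _ (dm_stable hD T hg') hp.
have [B] : inhabited (forall y : Slice Y, Pullback p (str y)).
  apply: inhabited_dep_choice => y.
  by have [B] := dm_pullback hD (str y) hp; exact: (inhabits (pb_swap B)).
pose Vv : Slice Y := Over v.
have [A] : inhabited (Pullback f (str Vv)).
  by have [A] := closure_pullback hD hS hI hC v hf; exact: (inhabits (pb_swap A)).
have [ψ φK ψK] := φ_bij Vv (B Vv).
pose ab y A k := a y A (B y) (b y A (B y) k).
(* Unrelated pullbacks [A'] and [A''] are allowed, as [ab] is independent of this choice. *)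
have ab_nat (y' y : Slice Y) (u : Hom y' y) A' A'' k :
    ab y' A' (k ∘ pb_hom u (B y') (B y)) = ab y A'' k ∘ pb_hom u (B y') (B y).
  by rewrite /ab (b_nat _ _ u _ A'') (a_nat _ _ u _ A'' _ (B y)).
(* The Yoneda correspondent of [ab]: its value at the universal element, transposed back. *)
pose e : @Hom (Slice Y) Vv Vv := ψ (ab Vv A (φ Vv (B Vv) (idm Vv))).
have φe y (A' : Pullback f (str y)) (h : @Hom (Slice Y) y Vv) :
    φ y (B y) (e ∘ h) = ab y A' (φ y (B y) h).
  rewrite (φ_nat _ _ h _ (B Vv)) ψK -(ab_nat _ _ h A') -(φ_nat _ _ h _ (B Vv)).
  by rewrite comp_id_l.
have φ_inj y h k : φ y (B y) h = φ y (B y) k -> h = k.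
  by move=> hk; have [χ χK _] := φ_bij y (B y); rewrite -(χK h) hk χK.
(* [b] after [a] is the identity, hence [ab] is idempotent. *)
have ee : e ∘ e = e.
  by apply: φ_inj; rewrite (φe _ A) ψK /ab aK.
have [S [r [j [jr rj]]]] := hC _ (under e) (f_equal (@under _ _ _ _) ee).
have vj : v ∘ j ∘ r = v by rewrite -comp_assoc jr; exact: under_str e.
pose Ss : Slice Y := Over (v ∘ j).
pose jj : @Hom (Slice Y) Ss Vv := @OverHom C Y Ss Vv j erefl.
pose rr : @Hom (Slice Y) Vv Ss := @OverHom C Y Vv Ss r vj.
have jjrr : jj ∘ rr = e by apply: slice_hom_eq.
have rrjj : rr ∘ jj = idm Ss by apply: slice_hom_eq.
(* [v ∘ j] is a retract over [Y] of the display map [v]. *)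
exists S, (v ∘ j); split.
  exact: (rlp_retract rj vj (subclass_closure hv)).
exists (fun y A' h => b y A' (B y) (φ y (B y) (jj ∘ h))); split.
- move=> y A'; have [χ χK Kχ] := φ_bij y (B y).
  (* The inverse embeds by [a], transposes to a map into [V] and projects to [S]. *)
  exists (fun k => rr ∘ χ (a y A' (B y) k)) => [h | k].
  + by rewrite -/(ab y A' _) -(φe y A') χK -jjrr -!comp_assoc
      !(comp_reassoc rrjj) !comp_id_l.
  + by rewrite comp_assoc jjrr (φe _ A') Kχ /ab !aK.
- move=> y' y u A' A'' h.
  by rewrite comp_assoc (φ_nat _ _ u _ (B y)) (b_nat _ _ u _ A'').
Qed.

(** * The two equivalences for a weak factorization system *)

Theorem corollary5p13 (C : Category) (L R : MorClass C)
    (hC : Cauchy_complete C) (hLR : weak_factorization_system L R) :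
  ((exists D : MorClass C, subclass D R /\ eqclass (closure D) R /\
      exists (hD : display_map_category D) (hS : models_Sigma D),
        models_functorial_Id hD hS)
   <->
   (exists (hR : display_map_category R) (hS : models_Sigma R),
        models_functorial_Id hR hS))
  /\
  ((exists D : MorClass C, subclass D R /\ eqclass (closure D) R /\
      exists (hD : display_map_category D) (hS : models_Sigma D),
        models_functorial_Id hD hS /\ models_Pi D)
   <->
   (exists (hR : display_map_category R) (hS : models_Sigma R),
        models_functorial_Id hR hS /\ models_Pi R)).
Proof.
have hR := wfs_closure hLR.
(* Classes with the same members are equal, so [closure D] replaces [R] throughout the goal. *)
split; split=> [[D [_ [/eqclass_eq <- [hD [hS h]]]]] | h].
- exists (closure_display_map_category hD hS (proj1 h) hC), (closure_models_Sigma (D := D)).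
  exact: closure_models_functorial_Id h.
(* [R] is its own closure, so [D] is taken to be [R]. *)
- by exists R; split=> //; split.
- case: h => hI hP.
  exists (closure_display_map_category hD hS (proj1 hI) hC), (closure_models_Sigma (D := D)).
  split; first exact: closure_models_functorial_Id hI.
  exact: closure_models_Pi hD hS hC (proj1 hI) hP.
- by exists R; split=> //; split.
Qed.
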